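(* Assume that $X[\mathcal{T}]$ is a locally convex topological vector space whose topology is generated by a family of seminorms $\langle\|\cdot\|_i\rangle_{i\in I}$; $|||\cdot|||$ is a seminorm on $X$ that is $\mathcal{T}$-lower-semicontinuous; $\langle X_k\rangle_{k\in\mathbb{N}}$ is a non-decreasing sequence of $\mathcal{T}$-closed vector subspaces whose union is $X$; $C_k=X_k\cap\{x:|||x|||\le k\}$ for each $k\in\mathbb{N}$; and $\mathcal{C}=\{C_k:k\in\mathbb{N}\}$. Then $\mathcal{C}$ is a non-decreasing countable localizing family consisting of $\mathcal{T}$-closed sets and the following hold. (A) For every sequence $\langle x_j\rangle_j$ in $X$ the following are equivalent: (a) $\lim_jx_j=0$ with respect to $\mathcal{T}_{\mathcal{C}}$; (b) (i) $\lim_j\|x_j\|_i=0$ for all $i\in I$, (ii) $\sup_j|||x_j|||<\infty$, and (iii) there exists $k\in\mathbb{N}$ such that $x_j\in X_k$ for all $j\in\mathbb{N}$. (B) For every $B\subseteq X$ the following are equivalent: (a) $B$ is $\mathcal{T}_{\mathcal{C}}$-bounded; (b) (i) $\sup_{x\in B}\|x\|_i<\infty$ for all $i\in I$, (ii) $\sup_{x\in B}|||x|||<\infty$, and (iii) there exists $k\in\mathbb{N}$ such that $B\subseteq X_k$. (C) The seminorm $|||\cdot|||$ is $\mathcal{T}_{\mathcal{C}}$-bounded (i.e. bounded on every $\mathcal{T}_{\mathcal{C}}$-bounded subset of $X$) and $\mathcal{T}_{\mathcal{C}}$-lower-semicontinuous.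
   Context: All vector spaces are real; topological vector spaces are Hausdorff. $X[\mathcal{T}]$ denotes $X$ equipped with the topology $\mathcal{T}$; $\mathcal{T}|_C=\{E\cap C:E\in\mathcal{T}\}$. A family of seminorms generates a locally convex topology in the usual way (it is separating, and finite intersections of closed seminorm balls centred at $0$ form a local base). A localizing family in a vector space $X$ is a non-empty collection $\mathcal{C}$ of convex subsets of $X$ containing $0$ such that for all $C\in\mathcal{C}$, $x\in X$, $t\in\mathbb{R}$ there is $D\in\mathcal{C}$ with $x+t\cdot C\subseteq D$. It is non-decreasing countable if it can be numbered $\mathcal{C}=\{C_k:k\in\mathbb{N}\}$ with $C_k\subseteq C_{k+1}$ for all $k$. The localization $\mathcal{T}_{\mathcal{C}}$ is the locally convex vector topology on $X$ consisting of all $E\subseteq X$ such that for every $x\in E$ there is a convex $V$ with $x\in V\subseteq E$ and $V\cap C\in\mathcal{T}|_C$ for every $C\in\mathcal{C}$. *)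

(* Defs.v *)
From HB Require Import structures.
From mathcomp Require Import all_boot all_order all_algebra.
From mathcomp Require Import all_classical all_reals all_analysis.

Set Implicit Arguments.
Unset Strict Implicit.
Unset Printing Implicit Defensive.

Import Order.TTheory GRing.Theory Num.Theory.
Import numFieldNormedType.Exports.

Local Open Scope classical_set_scope.
Local Open Scope ring_scope.

Definition seminorm (R : realType) (X : lmodType R) (p : X -> R) : Prop :=
  (forall x y, p (x + y) <= p x + p y) /\
  (forall (a : R) x, p (a *: x) = `|a| * p x).

Definition closed_seminorm_balls (R : realType) (X : lmodType R) (I : Type)
    (p : I -> X -> R) : set_system X :=
  [set B | exists (i : I) (r : R), 0 < r /\ B = [set x | p i x <= r]].

(* The topology of X is a given structure on X, a vector topology in the
   intended use, so that a local base at 0 determines it. *)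
Definition generated_by_seminorms (R : realType) (X : preTopologicalLmodType R)
    (I : Type) (p : I -> X -> R) : Prop :=
  [/\ forall i, seminorm (p i),
      forall x, (forall i, p i x = 0) -> x = 0 &
      forall U : set X, nbhs 0 U <->
        exists2 B, finI_from (closed_seminorm_balls p) id B & B `<=` U].

Definition localizing_family (R : realType) (X : lmodType R)
    (Cs : set_system X) : Prop :=
  [/\ Cs !=set0,
      forall C, Cs C -> convex_set C /\ C 0 &
      forall C (x : X) (t : R), Cs C ->
        exists2 D, Cs D & [set x + t *: y | y in C] `<=` D].

Definition nondecreasing_countable (T : Type) (Cs : set_system T) : Prop :=
  exists C : nat -> set T,
    Cs = range C /\ forall k, C k `<=` C k.+1.

Definition trace_topology (T : topologicalType) (C : set T) : set_system T :=
  [set E `&` C | E in (open : set_system T)].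

Definition localization_open (R : realType) (X : preTopologicalLmodType R)
    (Cs : set_system X) : set_system X :=
  [set E | forall x, E x -> exists V : set X,
    [/\ convex_set V, V x, V `<=` E &
        forall C, Cs C -> trace_topology C (V `&` C)]].

(* An alias of X, carrying the vector space structure of X and the topology
   whose open sets are localization_open Cs. *)
Definition localization (R : realType) (X : preTopologicalLmodType R)
  (Cs : set_system X) : Type := X.

Section localization_topology.
Context (R : realType) (X : preTopologicalLmodType R) (Cs : set_system X).

Let localization_openT : localization_open Cs setT.
Proof.
move=> x _; exists setT; split => //.
by move=> C _; exists setT => //; exact: openT.
Qed.

Let localization_openI : setI_closed (localization_open Cs).
Proof.
move=> E F oE oF x [/oE[V [cV Vx VE oV]] /oF[W [cW Wx WF oW]]].
exists (V `&` W); split => //.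
- by move=> y z l; rewrite !in_setI => /andP[yV yW] /andP[zV zW];
    rewrite cV// cW.
- exact: setISS.
- move=> C CsC; have [A oA AE] := oV C CsC; have [B oB BE] := oW C CsC.
  exists (A `&` B); first exact: openI.
  by rewrite setIIl AE BE -setIIl.
Qed.

Let localization_open_bigU (J : Type) (f : J -> set X) :
  (forall j, localization_open Cs (f j)) ->
  localization_open Cs (\bigcup_j f j).
Proof.
move=> of_ x [j _ /of_[V [cV Vx Vf oV]]]; exists V; split => //.
by move=> y /Vf fy; exists j.
Qed.

HB.instance Definition _ := GRing.Lmodule.on (localization Cs).
HB.instance Definition _ := isOpenTopological.Build (localization Cs)
  localization_openT localization_openI localization_open_bigU.

Lemma open_localizationE :
  (open : set_system (localization Cs)) = localization_open Cs.
Proof. by []. Qed.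

End localization_topology.

(* Rudin's definition: every neighbourhood U of 0 satisfies B `<=` t U for all
   sufficiently large t. *)
Definition tvs_bounded (R : realType) (X : preTopologicalLmodType R)
    (B : set X) : Prop :=
  forall U : set X, nbhs 0 U -> \forall t \near +oo, B `<=` *:%R t @` U.

(* Main.v *)
(* A subset of X that is bounded, or the range of a sequence that converges,
   in the localization is contained in some C_k. Otherwise one finds points
   z_k outside C_k, taken from the sequence, respectively of the form
   x_k / (k + 1) with x_k in the bounded set, and since the C_k are closed,
   convex and increasing, some neighbourhood of 0 for the localization
   contains no z_k, which is impossible. Conversely, on a fixed C_k the
   neighbourhoods of 0 for the localization are traces of neighbourhoods
   for the original topology, which are controlled by the seminorms. *)
Require Import Defs.
From HB Require Import structures.
From mathcomp Require Import all_boot all_order all_algebra.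
From mathcomp Require Import all_classical all_reals all_analysis.

Set Implicit Arguments.
Unset Strict Implicit.
Unset Printing Implicit Defensive.

Import Order.TTheory GRing.Theory Num.Theory.
Import numFieldNormedType.Exports.

Local Open Scope classical_set_scope.
Local Open Scope ring_scope.

(** * Neighbourhoods for the localization and for the original topology *)

Lemma open_localization (R : realType) (X : tvsType R) (Cs : set_system X)
    (E : set X) : open E -> localization_open Cs E.
Proof.
move=> oE x Ex; have [B Bconv [Bopen Bx]] := @locally_convex R X.
(* Local convexity supplies the convex [V] required by the localization; [V] is open, hence so are
   its traces. *)
have [V [BV Vx] VE] := Bx x E (open_nbhs_nbhs (conj oE Ex)).
exists V; split => //; first by apply: Bconv; rewrite inE.
by move=> C _; exists V; first exact: Bopen.
Qed.

Lemma nbhs_localization (R : realType) (X : tvsType R) (Cs : set_system X)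
    (x : X) (U : set X) :
  nbhs x U -> nbhs (x : localization Cs) (U : set (localization Cs)).
Proof.
rewrite !nbhsE => -[V [oV Vx] VU]; exists V; last by [].
by split=> //; exact: open_localization.
Qed.

(* The sets C k + W k, for small convex open neighbourhoods W k of 0, are
   convex and open and contain C k. Those of index k >= m contain C m, so
   that only finitely many of them matter for the trace on C m of their
   intersection. *)
Lemma localization_nbhs_avoid (R : realType) (X : tvsType R)
    (C : nat -> set X) (z : nat -> X) :
  (forall k, convex_set (C k)) -> (forall k, C k 0) ->
  (forall k, closed (C k)) -> {homo C : m n / (m <= n)%N >-> m `<=` n} ->
  (forall k, ~ C k (z k)) ->
  exists2 U : set (localization (range C)), nbhs 0 U & forall k, ~ U (z k).
Proof.
move=> Cconv C0 Cclosed Cmono Cz.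
have subc (u : X) : continuous (fun v : X => v - u).
  move=> v; apply: (@continuous2_cvg _ _ _ _ _ _ id (fun=> u)
    (fun a b : X => a - b)).
  - exact: (@sub_continuous X (v, u)).
  - exact: cvg_id.
  - exact: cvg_cst.
have csub (u : X) : continuous (fun v : X => u - v).
  move=> v; apply: (@continuous2_cvg _ _ _ _ _ _ (fun=> u) id
    (fun a b : X => a - b)).
  - exact: (@sub_continuous X (u, v)).
  - exact: cvg_cst.
  - exact: cvg_id.
(* The complement of the closed set [C k] contains [z k], so its preimage under [w => z k - w] is an
   open neighbourhood of 0 and contains a convex one. *)
have sep k : exists W : set X, [/\ convex_set W, open W, W 0 &
    forall w, W w -> ~ C k (z k - w)].
  have oD : open ((fun w : X => z k - w) @^-1` (~` C k)).
    apply: open_comp; last exact: closed_openC.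
    by move=> w _; exact: csub.
  have [B Bconv [Bopen B0]] := @locally_convex R X.
  have [|W [BW W0] WD] := B0 0 ((fun w : X => z k - w) @^-1` (~` C k)).
    by apply: open_nbhs_nbhs; split => //=; rewrite subr0; exact: Cz.
  by exists W; split => //; [apply: Bconv; rewrite inE|exact: Bopen].
have [W WP] := choice sep.
pose CW k := [set x : X | exists2 c, C k c & W k (x - c)].
have oCW k : open (CW k).
  have -> : CW k = \bigcup_(c in C k) ((fun x : X => x - c) @^-1` W k) by [].
  apply: bigcup_open => c _; apply: open_comp; first by move=> w _; exact: subc.
  by have [] := WP k.
have CCW k : C k `<=` CW k.
  by move=> c Cc; exists c => //; rewrite subrr; have [] := WP k.
have convCW k : convex_set (CW k).
  have [Wconv _ _ _] := WP k.
  move=> x y l; rewrite !inE => -[c Cc Wc] [d Cd Wd].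
  exists (conv l (c : convex_lmodType X) d).
    by have := Cconv k c d l; rewrite !inE; apply.
  have := Wconv (x - c) (y - d) l; rewrite !inE => /(_ Wc Wd).
  rewrite /conv/=; congr (W k _).
  by rewrite !scalerBr opprD addrACA.
exists (\bigcap_k CW k); last first.
  (* Otherwise [z k = c + w] with [c] in [C k] and [w] in [W k], and [z k - w = c] contradicts the
     choice of [W k]. *)
  move=> k /(_ k I)[c Cc Wc]; have [_ _ _ /(_ _ Wc)] := WP k.
  by rewrite subKr.
rewrite nbhsE; exists (\bigcap_k CW k) => //; split; last first.
  by move=> k _; apply: CCW; exact: C0.
rewrite /open/= -/(localization_open _ _) => x Ux.
(* The whole intersection is convex, so it serves as the convex set at each of its points. *)
exists (\bigcap_k CW k); split => //.
  move=> u v l; rewrite !inE => Uu Uv k _.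
  by have := convCW k u v l; rewrite !inE; apply; [exact: Uu|exact: Uv].
move=> _ [m _ <-].
exists (\bigcap_(k < m) CW k).
  rewrite bigcap_mkord; elim/big_ind: _ => //; first exact: openT.
  by move=> A B; exact: openI.
apply/seteqP; split=> y [Uy Cy]; split => // k.
  move=> _; have [km|mk] := ltnP k m; first exact: Uy.
  by apply: CCW; exact: (Cmono m).
by move=> _; exact: Uy.
Qed.

(** [U] contains a finite intersection of seminorm balls, and filters are stable under finite
    intersections. Taking sets [S j] instead of points covers both sequences (singletons) and
    bounded sets (their dilates). *)
Lemma near_sub_nbhs0 (R : realType) (X : preTopologicalLmodType R) (I : Type)
    (p : I -> X -> R) (J : Type) (F : set_system J) (S : J -> set X) :
  Filter F -> generated_by_seminorms p ->
  (forall i r, 0 < r -> \forall j \near F, S j `<=` [set x | p i x <= r]) ->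
  forall U : set X, nbhs 0 U -> \forall j \near F, S j `<=` U.
Proof.
move=> FF [_ _ pX] Sp U /pX[_ [D Dballs <-] DU].
have := @filter_bigI _ _ D (fun B => [set j | S j `<=` B]) F FF.
move=> /(_ _)/wrap[B DB|].
  by have /Dballs/set_mem[i [r [r0 ->]]] := DB; exact: Sp.
by apply: filterS => j Sj; apply: subset_trans DU => x Sx B DB; exact: (Sj B).
Qed.

(** * Seminorms and finite suprema *)

Lemma nbhs0_seminorm_ball (R : realType) (X : preTopologicalLmodType R)
    (I : Type) (p : I -> X -> R) (i : I) (r : R) :
  generated_by_seminorms p -> 0 < r -> nbhs 0 [set x | p i x <= r].
Proof.
move=> [_ _ pX] r0; apply/pX; exists [set x | p i x <= r] => //.
by apply: finI_from1; exists i, r.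
Qed.

Lemma seminorm0 (R : realType) (X : lmodType R) (q : X -> R) :
  seminorm q -> q 0 = 0.
Proof. by case=> _ qZ; rewrite -(scale0r 0) qZ normr0 mul0r. Qed.

Lemma seminorm_ge0 (R : realType) (X : lmodType R) (q : X -> R) (x : X) :
  seminorm q -> 0 <= q x.
Proof.
move=> qs; have [qD qZ] := qs.
have := qD x (- x); rewrite subrr (seminorm0 qs) -scaleN1r qZ normrN1 mul1r.
by rewrite -mulr2n pmulrn_lge0.
Qed.

Lemma ereal_sup_image_ltyP (R : realType) (T : Type) (f : T -> R) (B : set T) :
  (ereal_sup [set (f x)%:E | x in B] < +oo)%E <->
  exists M, forall x, B x -> f x <= M.
Proof.
split=> [|[M BM]]; last first.
  apply: le_lt_trans (ltry M); apply: ge_ereal_sup => _ [x Bx <-].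
  by rewrite lee_fin BM.
have ub x : B x -> ((f x)%:E <= ereal_sup [set (f x)%:E | x in B])%E.
  by move=> Bx; apply: ereal_sup_ubound; exists x.
case: (ereal_sup _) ub => [M|//|] ub _.
  by exists M => x /ub; rewrite lee_fin.
(* A supremum of [-oo] forces [B] to be empty, so any bound will do. *)
by exists 0 => x /ub; rewrite leeNy_eq.
Qed.

(** * Containment in a single [C k], and traces on it *)

Lemma localization_cvg_sub (R : realType) (X : tvsType R)
    (C : nat -> set X) (x_ : nat -> X) :
  (forall k, convex_set (C k)) -> (forall k, C k 0) ->
  (forall k, closed (C k)) -> {homo C : m n / (m <= n)%N >-> m `<=` n} ->
  \bigcup_k C k = [set: X] ->
  (x_ j : localization (range C)) @[j --> \oo] -->
    (0 : localization (range C)) ->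
  exists k, forall j, C k (x_ j).
Proof.
move=> Cconv C0 Cclosed Cmono Ccover x0; apply: contrapT => nC.
have /choice[j_ Cj] k : exists j, ~ C k (x_ j).
  by apply/existsNP => Ck; apply: nC; exists k.
have [U /x0[N _ NU] Uj] := localization_nbhs_avoid Cconv C0 Cclosed Cmono Cj.
(* The indices [j_ k] need not tend to infinity. The first [N] terms share one [C m], so [j_ m] is
   at least [N], and its term lies in [U] after all. *)
have [m Cm] : exists m, forall j, (j < N)%N -> C m (x_ j).
  elim: N {NU} => [|N [m Cm]]; first by exists 0%N.
  have [n _ Cn] : (\bigcup_k C k) (x_ N) by rewrite Ccover.
  exists (maxn m n) => j; rewrite ltnS leq_eqVlt => /predU1P[->|jN].
    exact: Cmono (leq_maxr _ _) _ Cn.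
  exact: Cmono (leq_maxl _ _) _ (Cm _ jN).
have [jN|Nj] := ltnP (j_ m) N; first exact: (Cj m (Cm _ jN)).
exact: (Uj m (NU _ Nj)).
Qed.

Lemma localization_bounded_sub (R : realType) (X : tvsType R)
    (C : nat -> set X) (B : set X) :
  (forall k, convex_set (C k)) -> (forall k, C k 0) ->
  (forall k, closed (C k)) -> {homo C : m n / (m <= n)%N >-> m `<=` n} ->
  (forall k (t : R), exists m, *:%R t @` C k `<=` C m) ->
  tvs_bounded (B : set (localization (range C))) ->
  exists k, B `<=` C k.
Proof.
move=> Cconv C0 Cclosed Cmono Cscale Bbnd; apply: contrapT => nC.
have /choice[x_ xP] k : exists x, B x /\ ~ C k (k.+1%:R^-1 *: x).
  (* If every [x / (k + 1)] with [x] in [B] were in [C k], then [B] would lie in [(k + 1) C k],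
     hence in some [C m]. *)
  have [m Cm] := Cscale k k.+1%:R.
  apply: contrapT => nx; apply: nC; exists m => x Bx; apply: Cm.
  exists (k.+1%:R^-1 *: x); last by rewrite scalerA divff// scale1r.
  by apply: contrapT => nCx; apply: nx; exists x.
have [U /Bbnd[M [_ MU]] Ux] := localization_nbhs_avoid Cconv C0 Cclosed Cmono
  (fun k => (xP k).2).
(* This makes [k + 1 > M], so [B] lies in [(k + 1) U]. *)
pose k := Num.truncn M.
have [u Uu ux] := MU k.+1%:R (truncnS_gt _) _ (xP k).1.
by apply: (Ux k); rewrite -ux scalerA mulVf// scale1r.
Qed.

(** The trace on [C] of a convex set around 0 equals that of an open [W]; since 0 is in [C], it is
    also in [W]. *)
Lemma localization_nbhs0_trace (R : realType) (X : preTopologicalLmodType R)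
    (Cs : set_system X) (U C : set X) :
  nbhs (0 : localization Cs) (U : set (localization Cs)) -> Cs C -> C 0 ->
  exists2 W : set X, nbhs 0 W & W `&` C `<=` U.
Proof.
rewrite nbhsE => -[E [oE E0] EU] CsC C0.
have [V [_ V0 VE /(_ _ CsC)[W oW WV]]] := oE 0 E0.
have [W0 _] : (W `&` C) 0 by rewrite WV.
exists W; first exact: open_nbhs_nbhs.
by rewrite WV => x [/VE/EU].
Qed.

Theorem theorem3p4 (R : realType) (X : tvsType R) (I : Type)
    (p : I -> X -> R) (q : X -> R) (X_ C_ : nat -> set X)
    (Cs : set_system X)
    (hausX : hausdorff_space X)
    (pX : generated_by_seminorms p)
    (q_seminorm : seminorm q)
    (q_lsc : lower_semicontinuous (fun x : X => (q x)%:E))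
    (X_subspace : forall k, submod_closed [in X_ k])
    (X_closed : forall k, closed (X_ k))
    (X_nondecreasing : forall k, X_ k `<=` X_ k.+1)
    (X_cover : \bigcup_k X_ k = [set: X])
    (C_def : forall k, C_ k = X_ k `&` [set x | q x <= k%:R])
    (Cs_def : Cs = range C_) :
  [/\ localizing_family Cs, nondecreasing_countable Cs &
      forall C, Cs C -> closed C] /\
  [/\ (* (A) *)
      forall x_ : nat -> X,
        (x_ j : localization Cs) @[j --> \oo] --> (0 : localization Cs) <->
        [/\ forall i, p i (x_ j) @[j --> \oo] --> (0 : R),
            (ereal_sup [set (q (x_ j))%:E | j in [set: nat]] < +oo)%E &
            exists k, forall j, X_ k (x_ j)],
      (* (B) *)
      forall B : set X,
        tvs_bounded (B : set (localization Cs)) <->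
        [/\ forall i, (ereal_sup [set (p i x)%:E | x in B] < +oo)%E,
            (ereal_sup [set (q x)%:E | x in B] < +oo)%E &
            exists k, B `<=` X_ k] &
      (* (C) *)
      (forall B : set X, tvs_bounded (B : set (localization Cs)) ->
        (ereal_sup [set (q x)%:E | x in B] < +oo)%E) /\
      lower_semicontinuous (fun x : localization Cs => (q x)%:E)].
Proof.

(* Properties of the sets [C_ k] *)
have qge0 x := seminorm_ge0 x q_seminorm.
have q0 := seminorm0 q_seminorm; have [qD qZ] := q_seminorm.
have XD k x y (a : R) : X_ k x -> X_ k y -> X_ k (a *: x + y).
  have [_ XS] := X_subspace k; move=> Xx Xy.
  by have := XS a x y; rewrite !inE; apply.
have X0 k : X_ k 0 by have [] := X_subspace k; rewrite inE.
have XZ k x (a : R) : X_ k x -> X_ k (a *: x).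
  by move=> Xx; rewrite -[_ *: _]addr0; exact: XD.
have X_mono : {homo X_ : m n / (m <= n)%N >-> m `<=` n}.
  by apply: homo_leq => //; [move=> A x|move=> A B D; exact: subset_trans].
have C_mono : {homo C_ : m n / (m <= n)%N >-> m `<=` n}.
  move=> m n mn x; rewrite !C_def => -[Xx /= qx]; split; first exact: X_mono Xx.
  by rewrite /= (le_trans qx)// ler_nat.
have C_conv k : convex_set (C_ k).
  move=> x y l; rewrite C_def !inE => -[Xx /= qx] [Xy /= qy].
  split; first by apply: XD => //; exact: XZ.
  have l1 : 0 <= 1 - l%:num by rewrite subr_ge0.
  rewrite /= /conv/= (le_trans (qD _ _))// !qZ !ger0_norm//.
  have -> : k%:R = l%:num * k%:R + (1 - l%:num) * k%:R.
    by rewrite -mulrDl subrKC mul1r.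
  by apply: lerD; apply: ler_wpM2l.
have C_0 k : C_ k 0 by rewrite C_def; split => //=; rewrite q0.
have C_closed k : closed (C_ k).
  rewrite C_def; apply: closedI => //.
  rewrite -[X in closed X]setCK; apply: open_closedC.
  (* The complement of the sublevel set is a strict superlevel set of [q], open by lower
     semicontinuity. *)
  have := (lower_semicontinuousP _).1 q_lsc k%:R; congr open.
  by apply/seteqP; split=> x /=; rewrite lte_fin ltNge => /negP.
(* One index governs both the subspace and the bound on [q]: it must be at least [m] and at least
   the real [M]. *)
have C_bnd m M x : X_ m x -> q x <= M -> C_ (maxn m (Num.truncn M).+1) x.
  move=> Xx qx; rewrite C_def; split; first exact: X_mono (leq_maxl _ _) _ Xx.
  rewrite /= (le_trans qx)// (le_trans (ltW (truncnS_gt M)))//.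
  by rewrite ler_nat leq_maxr.
have C_cover : \bigcup_k C_ k = [set: X].
  apply/seteqP; split => // x _; have [m _ Xx] : (\bigcup_k X_ k) x.
    by rewrite X_cover.
  by exists (maxn m (Num.truncn (q x)).+1) => //; exact: C_bnd.
have C_affine k (x : X) (t : R) :
    exists m, [set x + t *: y | y in C_ k] `<=` C_ m.
  have [m _ Xx] : (\bigcup_k X_ k) x by rewrite X_cover.
  exists (maxn (maxn m k) (Num.truncn (q x + `|t| * k%:R)).+1) => _ [y Cy <-].
  move: Cy; rewrite C_def => -[Xy /= qy]; apply: C_bnd.
    rewrite addrC; apply: XD; first exact: X_mono (leq_maxr _ _) _ Xy.
    exact: X_mono (leq_maxl _ _) _ Xx.
  by rewrite (le_trans (qD _ _))// lerD2l qZ ler_wpM2l.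
have C_scale k (t : R) : exists m, *:%R t @` C_ k `<=` C_ m.
  have [m Cm] := C_affine k 0 t; exists m => _ [y Cy <-].
  by apply: Cm; exists y; rewrite ?add0r.
have C_shrink k (a : R) x : `|a| <= 1 -> C_ k x -> C_ k (a *: x).
  move=> a1; rewrite C_def => -[Xx /= qx]; split; first exact: XZ.
  by rewrite /= qZ (le_trans _ qx)// ler_piMl.
(* Conditions (ii) and (iii) together amount to containment in one [C_ k]. *)
have C_bndP (B : set X) : (exists k, B `<=` C_ k) <->
    (ereal_sup [set (q x)%:E | x in B] < +oo)%E /\ exists k, B `<=` X_ k.
  split=> [[k BC]|[/ereal_sup_image_ltyP[M BM] [k BX]]].
    split; last by exists k => x /BC; rewrite C_def => -[].
    by apply/ereal_sup_image_ltyP; exists k%:R => x /BC; rewrite C_def => -[].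
  exists (maxn k (Num.truncn M).+1) => x Bx.
  by apply: C_bnd; [exact: BX|exact: BM].
have p_ge0 i x : 0 <= p i x by case: pX => ps _ _; exact: seminorm_ge0.
have pZ i (a : R) x : p i (a *: x) = `|a| * p i x.
  by case: pX => /(_ i)[_ ->].
have p_nbhs i r : 0 < r ->
    nbhs (0 : localization Cs) ([set x | p i x <= r] : set (localization Cs)).
  by move=> r0; apply: nbhs_localization; exact: nbhs0_seminorm_ball.
have bounded_sub (B : set X) :
    tvs_bounded (B : set (localization Cs)) -> exists k, B `<=` C_ k.
  by rewrite Cs_def; exact: localization_bounded_sub.
split; first split.
- split; first by rewrite Cs_def; exists (C_ 0%N), 0%N.
    by move=> C; rewrite Cs_def => -[k _ <-].
  move=> C x t; rewrite Cs_def => -[k _ <-].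
  by have [m Cm] := C_affine k x t; exists (C_ m); first exists m.
- by exists C_; split => // k; exact: C_mono.
- by move=> C; rewrite Cs_def => -[k _ <-].
split.

(* Null sequences (A) *)
- move=> x_; split=> [x0|[px qx Xx]].
    have [k Ck] : exists k, forall j, C_ k (x_ j).
      by move: x0; rewrite Cs_def; exact: localization_cvg_sub.
    split.
    + move=> i; apply/cvgr0Pnorm_le => e /(p_nbhs i)/x0[N _ Np].
      by exists N => // j /Np /=; rewrite ger0_norm.
    + by apply/ereal_sup_image_ltyP; exists k%:R => j _; move: (Ck j);
        rewrite C_def => -[].
    + by exists k => j; move: (Ck j); rewrite C_def => -[].
  have [k Ck] : exists k, range x_ `<=` C_ k.
    apply/C_bndP; split; last by case: Xx => k Xk; exists k => _ [j _ <-].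
    move: qx; congr (ereal_sup _ < _)%E; apply/seteqP; split => [_ [j _ <-]|].
      by exists (x_ j) => //; exists j.
    by move=> _ [_ [j _ <-] <-]; exists j.
  move=> U /(@localization_nbhs0_trace _ _ _ _ (C_ k))[||W W0 WU] //.
    by rewrite Cs_def; exists k.
  have : \forall j \near \oo, [set x_ j] `<=` W.
    apply: near_sub_nbhs0 pX _ _ W0 => i r r0.
    move/cvgr0Pnorm_le: (px i) => /(_ r r0).
    by apply: filterS => j; rewrite ger0_norm// => pr _ ->.
  apply: filterS => j /(_ _ erefl) Wj; apply: WU; split => //.
  by apply: Ck; exists j.

(* Bounded sets (B) *)
- move=> B; split=> [Bbnd|[pB qB XB]].
    have /C_bndP[qB XB] := bounded_sub _ Bbnd; split => // i.
    have [M [_ MB]] := Bbnd _ (p_nbhs i 1 ltr01).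
    (* [|M| + 1] is positive and exceeds [M], so [B] lies in this multiple of the unit ball of
       [p i]. *)
    apply/ereal_sup_image_ltyP; exists (`|M| + 1) => x Bx.
    have Mt : M < `|M| + 1 by rewrite ltr_pwDr// ler_norm.
    have [y /= py <-] := MB _ Mt _ Bx.
    by rewrite pZ ger0_norm ?addr_ge0// ler_piMr ?addr_ge0.
  have [k Ck] := (C_bndP B).2 (conj qB XB).
  move=> U /(@localization_nbhs0_trace _ _ _ _ (C_ k))[||W W0 WU] //.
    by rewrite Cs_def; exists k.
  have : \forall t \near +oo, [set t^-1 *: x | x in B] `<=` W.
    apply: near_sub_nbhs0 pX _ _ W0 => i r r0.
    have /ereal_sup_image_ltyP[M BM] := pB i.
    near=> t.
    have t0 : 0 < t by near: t; exact: nbhs_pinfty_gt.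
    (* This gives [p i (t^-1 *: x) <= M / t <= r] on [B]. *)
    have Mt : M / r <= t by near: t; apply: nbhs_pinfty_ge; exact: num_real.
    move=> _ [x Bx <-] /=.
    rewrite pZ gtr0_norm ?invr_gt0// [leLHS]mulrC ler_pdivrMr//.
    by rewrite (le_trans (BM _ Bx))// mulrC -ler_pdivrMr.
  move=> BW; near=> t.
  (* With [t >= 1], [C_shrink] keeps [t^-1 *: x] inside [C_ k], where [W] controls [U]. *)
  have t1 : 1 <= t by near: t; exact: nbhs_pinfty_ge.
  have BWt : [set t^-1 *: x | x in B] `<=` W by near: t.
  move=> x Bx.
  have t0 : 0 < t by exact: lt_le_trans t1.
  exists (t^-1 *: x); last by rewrite scalerA divff ?gt_eqF// scale1r.
  apply: WU; split; last first.
    apply: C_shrink; last exact: Ck.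
    by rewrite ger0_norm ?invr_ge0 ?invf_le1// ltW.
  by apply: BWt; exists x.
split; first by move=> B /bounded_sub/C_bndP[].
(* Lower semicontinuity passes to the finer topology. *)
move=> x a /q_lsc[V Vx Va]; exists V => //.
exact: nbhs_localization.
Unshelve. all: by end_near. Qed.
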